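(* Let $p$ be a prime. For all $n\in\mathbb N$ with $n\neq 0$, $$\|n\|_p=\min\left\{\frac{\theta_p(0^k)(n)}{n}\right\}_{k\in\mathbb N},$$ where the minimum is over those $k$ for which $\theta_p(0^k)(n)$ is defined.
   Context: $\mathbb N=\{0,1,2,\dots\}$. $\|n\|_p=p^{-ord_p(n)}$ for $n\ge 1$, with $ord_p(n)=\max\{k\in\mathbb N:p^k\mid n\}$, is the $p$-adic norm. $\mathcal P_p$ (the $p$-th polycyclic monoid) is the inverse monoid with zero $\epsilon$ generated by $\{0,\dots,p-1\}$ subject to $xy^\ddagger=Id$ if $x=y$ and $xy^\ddagger=\epsilon$ if $x\neq y$. $\theta_p$ is the injective inverse monoid homomorphism from $\mathcal P_p$ to the monoid of partial injections on $\mathbb N$ (under composition of partial functions) with $\theta_p(x)=R_{p,x}$ for $0\le x<p$, where for $a>b\in\mathbb N$ the partial injection $R_{a,b}$ has domain $\{am+b:m\in\mathbb N\}$ and $R_{a,b}(n)=\frac{n-b}{a}$. The word $0^k=00\cdots0$ denotes the string of $k$ copies of the generator $0$ (the identity when $k=0$). *)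

(* Defs.v *)
From HB Require Import structures.
From mathcomp Require Import all_boot all_order all_algebra.
From mathcomp Require Import boolp classical_sets.

Set Implicit Arguments.
Unset Strict Implicit.
Unset Printing Implicit Defensive.

Import Order.TTheory GRing.Theory Num.Theory.

(* Inverse monoids are given by their standard equational axiomatisation over
   monoids with involution; [x^-1] is the generalised inverse of [x], and
   [ginv_unique] below shows that it is the only one.                        *)
HB.mixin Record StarMonoid_isInverse G of StarMonoid G := {
  mulgVg : forall x : G, (x * x^-1 * x = x)%g;
  mulgV_comm : forall x y : G,
    ((x * x^-1) * (y * y^-1) = (y * y^-1) * (x * x^-1))%g
}.

#[short(type="inverseMonoidType")]
HB.structure Definition InverseMonoid :=
  {G of StarMonoid_isInverse G & StarMonoid G}.

HB.mixin Record InverseMonoid_hasZero G of InverseMonoid G := {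
  epsg : G;
  mulepsg : forall x : G, (epsg * x = epsg)%g;
  mulgeps : forall x : G, (x * epsg = epsg)%g
}.

#[short(type="inverseMonoidZeroType")]
HB.structure Definition InverseMonoidZero :=
  {G of InverseMonoid_hasZero G & InverseMonoid G}.

Local Open Scope group_scope.

Section InverseMonoidTheory.
Variable G : inverseMonoidType.
Implicit Types e x y : G.

Lemma mulVgV x : x^-1 * x * x^-1 = x^-1.
Proof. by rewrite -[in X in _ * X * _](invgK x) mulgVg. Qed.

Lemma idem_inv e : e * e = e -> e * e^-1 = e.
Proof.
move=> ee; have eeV : e^-1 * e^-1 = e^-1 by rewrite -invgM ee.
have := mulgV_comm e e^-1; rewrite invgK => C.
have H1 : (e^-1 * e) * (e * e^-1) = e^-1.
  by rewrite -mulgA [e * (e * _)]mulgA ee mulgA mulVgV.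
have H2 : (e * e^-1) * (e^-1 * e) = e.
  by rewrite -mulgA [e^-1 * (e^-1 * _)]mulgA eeV mulgA mulgVg.
suff eV : e^-1 = e by rewrite eV.
by rewrite -[LHS]H1 -C H2.
Qed.

Lemma idem_comm e f : e * e = e -> f * f = f -> e * f = f * e.
Proof. by move=> /idem_inv <- /idem_inv <-; apply: mulgV_comm. Qed.

Lemma ginv_unique x y : x * y * x = x -> y * x * y = y -> y = x^-1.
Proof.
move=> xyx yxy.
have i1 : (x * y) * (x * y) = x * y by rewrite mulgA xyx.
have i2 : (y * x) * (y * x) = y * x by rewrite mulgA yxy.
have i3 : (x * x^-1) * (x * x^-1) = x * x^-1 by rewrite mulgA mulgVg.
have i4 : (x^-1 * x) * (x^-1 * x) = x^-1 * x by rewrite mulgA mulVgV.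
have yE : y = x^-1 * x * y.
  rewrite -[LHS]yxy.
  have -> : y * x = (y * x) * (x^-1 * x) by rewrite mulgA -!(mulgA y) mulgVg.
  by rewrite (idem_comm i2 i4) -mulgA yxy.
have VE : x^-1 = x^-1 * (x * y).
  rewrite -[LHS]mulVgV -mulgA.
  have -> : x / x = (x * y) * (x / x) by rewrite mulgA xyx.
  by rewrite (idem_comm i1 i3) !mulgA mulVgV.
by rewrite [LHS]yE -mulgA -VE.
Qed.

End InverseMonoidTheory.

Lemma invgeps (G : inverseMonoidZeroType) : epsg^-1 = epsg :> G.
Proof. by rewrite -[LHS]mulVgV mulgeps mulepsg. Qed.

Definition inverse_monoid_morphism (G H : inverseMonoidZeroType) (f : G -> H) :=
  [/\ f 1 = 1, {morph f : x y / x * y}, {morph f : x / x^-1}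
    & f epsg = epsg].

Section PolycyclicMonoid.
Variable p : nat.

Inductive polycyclic_term :=
  | PGen of 'I_p
  | PEps
  | POne
  | PInv of polycyclic_term
  | PMul of polycyclic_term & polycyclic_term.

HB.instance Definition _ := gen_eqMixin polycyclic_term.
HB.instance Definition _ := gen_choiceMixin polycyclic_term.

(* The least congruence whose quotient is an inverse monoid with zero in which
   the last two constructors, the defining relations, hold.                  *)
Inductive polycyclic_cong : polycyclic_term -> polycyclic_term -> Prop :=
  | pc_refl x : polycyclic_cong x x
  | pc_sym x y : polycyclic_cong x y -> polycyclic_cong y x
  | pc_trans y x z :
      polycyclic_cong x y -> polycyclic_cong y z -> polycyclic_cong x z
  | pc_inv x y : polycyclic_cong x y -> polycyclic_cong (PInv x) (PInv y)
  | pc_mul x x' y y' : polycyclic_cong x x' -> polycyclic_cong y y' ->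
      polycyclic_cong (PMul x y) (PMul x' y')
  | pc_mulA x y z :
      polycyclic_cong (PMul x (PMul y z)) (PMul (PMul x y) z)
  | pc_mul1 x : polycyclic_cong (PMul POne x) x
  | pc_invK x : polycyclic_cong (PInv (PInv x)) x
  | pc_invM x y :
      polycyclic_cong (PInv (PMul x y)) (PMul (PInv y) (PInv x))
  | pc_mulV x : polycyclic_cong (PMul (PMul x (PInv x)) x) x
  | pc_mulV_comm x y :
      polycyclic_cong (PMul (PMul x (PInv x)) (PMul y (PInv y)))
                      (PMul (PMul y (PInv y)) (PMul x (PInv x)))
  | pc_eps_mul x : polycyclic_cong (PMul PEps x) PEps
  | pc_mul_eps x : polycyclic_cong (PMul x PEps) PEps
  | pc_gen_eq x : polycyclic_cong (PMul (PGen x) (PInv (PGen x))) POne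
  | pc_gen_neq x y : x != y ->
      polycyclic_cong (PMul (PGen x) (PInv (PGen y))) PEps.

Definition polycyclic_congb x y := `[< polycyclic_cong x y >].

Lemma polycyclic_cong_equiv : equiv_class_of polycyclic_congb.
Proof.
split.
- by move=> x; apply/asboolP; apply: pc_refl.
- by move=> x y; apply/asboolP/asboolP => /pc_sym.
- by move=> y x z /asboolP xy /asboolP yz; apply/asboolP; apply: pc_trans yz.
Qed.

Canonical polycyclic_equiv := EquivRelPack polycyclic_cong_equiv.

Definition polycyclic := {eq_quot polycyclic_equiv}%qT.
HB.instance Definition _ := Choice.on polycyclic.
HB.instance Definition _ := EqQuotient.on polycyclic.

Local Notation pi := (\pi_polycyclic)%qT.

Lemma polycyclic_piP x y : pi x = pi y <-> polycyclic_cong x y.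
Proof. by split=> [/eqquotP/asboolP|xy]; [|apply/eqquotP/asboolP]. Qed.

Lemma polycyclic_reprP x : polycyclic_cong (repr (pi x)) x.
Proof. by apply/polycyclic_piP; rewrite reprK. Qed.

Definition pgen (x : 'I_p) : polycyclic := pi (PGen x).
Definition peps : polycyclic := pi PEps.
Definition pone : polycyclic := pi POne.
Definition pinv (x : polycyclic) : polycyclic := pi (PInv (repr x)).
Definition pmul (x y : polycyclic) : polycyclic := pi (PMul (repr x) (repr y)).

Lemma pi_inv x : pi (PInv x) = pinv (pi x).
Proof.
by apply/polycyclic_piP/pc_inv/pc_sym/polycyclic_reprP.
Qed.

Lemma pi_mul x y : pi (PMul x y) = pmul (pi x) (pi y).
Proof.
by apply/polycyclic_piP/pc_mul; apply/pc_sym/polycyclic_reprP.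
Qed.

Let pI (P : polycyclic -> Prop) : (forall t, P (pi t)) -> forall x, P x.
Proof. by move=> H x; rewrite -[x]reprK. Qed.

Let pmulA : associative pmul.
Proof.
elim/pI=> x; elim/pI=> y; elim/pI=> z; rewrite -!pi_mul.
exact/polycyclic_piP/pc_mulA.
Qed.

Let pmul1 : left_id pone pmul.
Proof. by elim/pI=> x; rewrite -pi_mul; apply/polycyclic_piP/pc_mul1. Qed.

Let pinvK : involutive pinv.
Proof. by elim/pI=> x; rewrite -!pi_inv; apply/polycyclic_piP/pc_invK. Qed.

Let pinvM : {morph pinv : x y / pmul x y >-> pmul y x}.
Proof.
elim/pI=> x; elim/pI=> y; rewrite -!(pi_mul, pi_inv).
exact/polycyclic_piP/pc_invM.
Qed.

HB.instance Definition _ :=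
  isStarMonoid.Build polycyclic pmulA pmul1 pinvK pinvM.

Let pmulV (x : polycyclic) : x * x^-1 * x = x.
Proof.
elim/pI: x => x; have /polycyclic_piP := pc_mulV x.
by rewrite !(pi_mul, pi_inv).
Qed.

Let pmulV_comm (x y : polycyclic) :
  (x * x^-1) * (y * y^-1) = (y * y^-1) * (x * x^-1).
Proof.
elim/pI: x => x; elim/pI: y => y; have /polycyclic_piP := pc_mulV_comm x y.
by rewrite !(pi_mul, pi_inv).
Qed.

HB.instance Definition _ :=
  StarMonoid_isInverse.Build polycyclic pmulV pmulV_comm.

Let peps_mul (x : polycyclic) : peps * x = peps.
Proof.
elim/pI: x => x; have /polycyclic_piP := pc_eps_mul x.
by rewrite !pi_mul.
Qed.

Let pmul_eps (x : polycyclic) : x * peps = peps.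
Proof.
elim/pI: x => x; have /polycyclic_piP := pc_mul_eps x.
by rewrite !pi_mul.
Qed.

HB.instance Definition _ :=
  InverseMonoid_hasZero.Build polycyclic peps_mul pmul_eps.

Lemma pgenE (x y : 'I_p) :
  pgen x * (pgen y)^-1 = if x == y then 1 else epsg.
Proof.
case: eqVneq => [<-|xy].
  by have /polycyclic_piP := pc_gen_eq x; rewrite pi_mul pi_inv.
by have /polycyclic_piP := pc_gen_neq xy; rewrite pi_mul pi_inv.
Qed.

Lemma polycyclic_ind (P : polycyclic -> Prop) :
  (forall x, P (pgen x)) -> P epsg -> P 1 ->
  (forall x, P x -> P x^-1) -> (forall x y, P x -> P y -> P (x * y)) ->
  forall x, P x.
Proof.
move=> Hg He H1 HV HM; elim/pI; elim=> //= [x|x + y].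
  by rewrite pi_inv; apply: HV.
by rewrite pi_mul; apply: HM.
Qed.

Section Lift.
Variables (G : inverseMonoidZeroType) (f : 'I_p -> G).

Fixpoint polycyclic_eval (t : polycyclic_term) : G :=
  match t with
  | PGen x => f x
  | PEps => epsg
  | POne => 1
  | PInv x => (polycyclic_eval x)^-1
  | PMul x y => polycyclic_eval x * polycyclic_eval y
  end.

Definition polycyclic_lift (x : polycyclic) : G := polycyclic_eval (repr x).

Hypothesis fP : forall x y, f x * (f y)^-1 = if x == y then 1 else epsg.

Lemma polycyclic_eval_cong x y :
  polycyclic_cong x y -> polycyclic_eval x = polycyclic_eval y.
Proof.
elim=> {x y} //=.
- by move=> y x z _ -> _.
- by move=> x y _ ->.
- by move=> x x' y y' _ -> _ ->.
- by move=> *; apply: mulgA.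
- by move=> *; apply: mul1g.
- by move=> *; apply: invgK.
- by move=> *; apply: invgM.
- by move=> *; apply: mulgVg.
- by move=> *; apply: mulgV_comm.
- by move=> *; apply: mulepsg.
- by move=> *; apply: mulgeps.
- by move=> x; rewrite fP eqxx.
- by move=> x y xy; rewrite fP (negPf xy).
Qed.

Lemma polycyclic_lift_pi t : polycyclic_lift (pi t) = polycyclic_eval t.
Proof. exact/polycyclic_eval_cong/polycyclic_reprP. Qed.

Lemma polycyclic_lift_gen x : polycyclic_lift (pgen x) = f x.
Proof. exact: polycyclic_lift_pi. Qed.

Lemma polycyclic_lift_morph : inverse_monoid_morphism polycyclic_lift.
Proof.
split; [exact: polycyclic_lift_pi|  | |exact: polycyclic_lift_pi].
- by elim/pI=> x; elim/pI=> y; rewrite -[_ * _]pi_mul !polycyclic_lift_pi.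
- by elim/pI=> x; rewrite -[_^-1]pi_inv !polycyclic_lift_pi.
Qed.

Lemma polycyclic_lift_unique (h : polycyclic -> G) :
  inverse_monoid_morphism h -> (forall x, h (pgen x) = f x) ->
  h =1 polycyclic_lift.
Proof.
have [L1 LM LV Le] := polycyclic_lift_morph.
move=> [h1 hM hV he] hf; elim/polycyclic_ind => [x|||x|x y].
- by rewrite hf polycyclic_lift_gen.
- by rewrite he Le.
- by rewrite h1 L1.
- by rewrite hV LV => ->.
- by rewrite hM LM => -> ->.
Qed.

End Lift.
End PolycyclicMonoid.

Section PartialInjections.
Variable T : Type.

Record partial_injection := PartialInjection {
  pinj_fun :> T -> option T;
  pinj_inj : forall x y z, pinj_fun x = Some z -> pinj_fun y = Some z -> x = y
}.

HB.instance Definition _ := gen_eqMixin partial_injection.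
HB.instance Definition _ := gen_choiceMixin partial_injection.

Implicit Types f g : partial_injection.

Lemma pinjP f g : (forall x y, f x = Some y <-> g x = Some y) -> f = g.
Proof.
case: f g => [f fi] [g gi] /= fg; have {}fg : f = g.
  apply/funext=> x; case fx: (f x) => [y|]; first by move/fg: fx.
  by case gx: (g x) => [y|//]; move/fg: gx; rewrite fx.
by case: _ / fg in gi *; congr PartialInjection; apply: Prop_irrelevance.
Qed.

Lemma pinj_one_subproof x y z : Some x = Some z -> Some y = Some z -> x = y :> T.
Proof. by move=> [->] [->]. Qed.
Definition pinj_one := PartialInjection pinj_one_subproof.

Lemma pinj_eps_subproof x y (z : T) :
  None = Some z -> None = Some z -> x = y :> T.
Proof. by []. Qed.
Definition pinj_eps := PartialInjection pinj_eps_subproof.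

(* [pcomp f g] applies [g] first. *)
Lemma pinj_mul_subproof f g x y z :
  pcomp f g x = Some z -> pcomp f g y = Some z -> x = y.
Proof.
rewrite /pcomp; case gx: (g x) => [u|//]; case gy: (g y) => [v|//] /= fu fv.
by rewrite (pinj_inj fu fv) in gx; apply: pinj_inj gx gy.
Qed.
Definition pinj_mul f g := PartialInjection (@pinj_mul_subproof f g).

Definition pinj_inv_fun f (y : T) : option T :=
  if pselect (exists x, f x = Some y) is left fy then Some (projT1 (cid fy))
  else None.

Lemma pinj_inv_funE f x y : pinj_inv_fun f y = Some x <-> f x = Some y.
Proof.
rewrite /pinj_inv_fun; case: pselect => [fy|nfy]; last first.
  by split=> // fx; case: nfy; exists x.
case: cid => x' /= fx'; split=> [[<-] //|fx]; congr Some.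
exact: pinj_inj fx' fx.
Qed.

Lemma pinj_inv_subproof f x y z :
  pinj_inv_fun f x = Some z -> pinj_inv_fun f y = Some z -> x = y.
Proof. by move=> /pinj_inv_funE fx /pinj_inv_funE; rewrite fx => -[]. Qed.
Definition pinj_inv f := PartialInjection (@pinj_inv_subproof f).

Lemma pinj_mulE f g x z :
  pinj_mul f g x = Some z <-> exists2 y, g x = Some y & f y = Some z.
Proof.
rewrite /= /pcomp; case: (g x) => [y|] /=; last by split=> [|[]].
by split=> [|[_ [->]]//]; exists y.
Qed.

Let pinj_mulA : associative pinj_mul.
Proof.
move=> f g h; apply/pinjP=> x y; rewrite /= /pcomp /=.
by case: (h x) => //= ? .
Qed.

Let pinj_mul1 : left_id pinj_one pinj_mul.
Proof. by move=> f; apply/pinjP=> x y; rewrite /= /pcomp; case: (f x). Qed.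

Let pinj_invK : involutive pinj_inv.
Proof. by move=> f; apply/pinjP=> x y; rewrite !pinj_inv_funE. Qed.

Let pinj_invM :
  {morph pinj_inv : f g / pinj_mul f g >-> pinj_mul g f}.
Proof.
move=> f g; apply/pinjP=> x y; rewrite pinj_inv_funE !pinj_mulE.
by split=> -[z]; [exists z|exists z]; apply/pinj_inv_funE.
Qed.

HB.instance Definition _ :=
  isStarMonoid.Build partial_injection pinj_mulA pinj_mul1 pinj_invK pinj_invM.

Let pinj_dom f x z :
  (f * f^-1 : partial_injection) x = Some z <-> x = z /\ exists y, f y = Some x.
Proof.
split=> [/pinj_mulE[y /pinj_inv_funE fy]|[<- [y fy]]].
  by rewrite fy => -[<-]; split=> //; exists y.
by apply/pinj_mulE; exists y => //; apply/pinj_inv_funE.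
Qed.

Let pinj_mulV f : f * f^-1 * f = f.
Proof.
apply/pinjP=> x y; split=> [/pinj_mulE[z fx /pinj_dom[<- //]]|fx].
by apply/pinj_mulE; exists y => //; apply/pinj_dom; split=> //; exists x.
Qed.

Let pinj_mulV_comm f g :
  (f * f^-1) * (g * g^-1) = (g * g^-1) * (f * f^-1).
Proof.
by apply/pinjP=> x y; split=> /pinj_mulE[z /pinj_dom[<- ?] /pinj_dom[<- ?]];
  apply/pinj_mulE; exists x; apply/pinj_dom.
Qed.

HB.instance Definition _ :=
  StarMonoid_isInverse.Build partial_injection pinj_mulV pinj_mulV_comm.

Let pinj_eps_mul f : pinj_eps * f = pinj_eps.
Proof. by apply/pinjP=> x y; rewrite pinj_mulE; split=> [[]|]. Qed.

Let pinj_mul_eps f : f * pinj_eps = pinj_eps.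
Proof. by apply/pinjP=> x y; rewrite pinj_mulE; split=> [[]|]. Qed.

HB.instance Definition _ :=
  InverseMonoid_hasZero.Build partial_injection pinj_eps_mul pinj_mul_eps.

End PartialInjections.

Section Theta.
Local Open Scope nat_scope.

(* Since [b < a], [n %% a == b] says that [n] is of the form [a * m + b], and
   [R_funE] below is the graph of the partial function.                      *)
Definition R_fun (a : nat) (b : 'I_a) (n : nat) : option nat :=
  if n %% a == b then Some ((n - b) %/ a) else None.

Lemma R_funE a (b : 'I_a) n m : R_fun b n = Some m <-> n = a * m + b.
Proof.
have a_gt0 : 0 < a by apply: leq_ltn_trans (ltn_ord b).
rewrite /R_fun; split=> [|->]; last first.
  by rewrite mulnC modnMDl modn_small // eqxx addnK mulnK.
case: eqP => // nb [<-]; rewrite -nb.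
have nE : n - n %% a = n %/ a * a by rewrite {1}(divn_eq n a) addnK.
by rewrite nE mulnK // mulnC -divn_eq.
Qed.

Lemma R_inj a (b : 'I_a) x y z :
  R_fun b x = Some z -> R_fun b y = Some z -> x = y.
Proof. by move=> /R_funE -> /R_funE ->. Qed.

Definition R_ (a : nat) (b : 'I_a) : partial_injection nat :=
  PartialInjection (@R_inj a b).

Definition theta (p : nat) : polycyclic p -> partial_injection nat :=
  polycyclic_lift (@R_ p).

Lemma R_rel p (x y : 'I_p) : (R_ x * (R_ y)^-1 = if x == y then 1 else epsg)%g.
Proof.
apply/pinjP=> n m; rewrite pinj_mulE; split.
  move=> [k /pinj_inv_funE /R_funE -> /R_funE].
  have p_gt0 : 0 < p by apply: leq_ltn_trans (ltn_ord x).
  move=> E; have xy : x = y.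
    have := congr1 (modn^~ p) E; rewrite /= ![p * _]mulnC !modnMDl !modn_small //.
    by move=> /esym/val_inj.
  rewrite xy eqxx; move: E; rewrite xy => /addIn /eqP.
  by rewrite eqn_pmul2l // => /eqP ->.
case: eqVneq => [<- [->]|//].
by exists (p * m + x); [apply/pinj_inv_funE|]; apply/R_funE.
Qed.

Lemma theta_morph p : inverse_monoid_morphism (@theta p).
Proof. exact/polycyclic_lift_morph/R_rel. Qed.

Lemma theta_gen p (x : 'I_p) : theta (pgen x) = R_ x.
Proof. exact/polycyclic_lift_gen/R_rel. Qed.

Lemma theta_unique p (h : polycyclic p -> partial_injection nat) :
  inverse_monoid_morphism h -> (forall x, h (pgen x) = R_ x) ->
  h =1 @theta p.
Proof. exact/polycyclic_lift_unique/R_rel. Qed.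

Section Injectivity.
Variable p : nat.
Implicit Types (u v : seq 'I_p) (x : polycyclic p).

Definition pword u : polycyclic p := (\prod_(a <- u) pgen a)%g.

Fixpoint pval u (m : nat) : nat :=
  if u is a :: u' then pval u' (p * m + a) else m.

Lemma pval_rcons u a m : pval (rcons u a) m = p * pval u m + a.
Proof. by elim: u m => //= b u IH m; rewrite IH. Qed.

Lemma pword_rcons u a : pword (rcons u a) = (pword u * pgen a)%g.
Proof. by rewrite /pword -cats1 big_cat big_seq1. Qed.

Lemma polycyclic_normal x :
  x = epsg \/ exists u v, (x = (pword u)^-1 * pword v)%g.
Proof.
pose N y := y = epsg \/ exists u v, (y = (pword u)^-1 * pword v)%g.
have N1 : N 1%g.
  by right; exists [::], [::]; rewrite /pword big_nil invg1 mulg1.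
suff H y : (N y -> N (x * y)%g) /\ (N y -> N (x^-1 * y)%g).
  by rewrite -[x]mulg1; apply: (H 1%g).1.
have Neps : N epsg by left.
elim/polycyclic_ind: x y => [a|||x IH|x z IHx IHz] y.
- split=> -[->|[u [v ->]]]; rewrite ?mulgeps //; last first.
    right; exists (rcons u a), v.
    by rewrite pword_rcons invgM mulgA.
  case/lastP: u => [|u b].
    right; exists [::], (a :: v).
    by rewrite /pword big_nil big_cons invg1 !mul1g.
  rewrite pword_rcons invgM !mulgA pgenE; case: eqP => _; last first.
    by rewrite !mulepsg.
  by right; exists u, v; rewrite mul1g.
- by rewrite invgeps mulepsg.
- by rewrite invg1 !mul1g.
- by rewrite invgK; have [] := IH y.
- rewrite invgM -!mulgA; split=> Ny.
    by apply: (IHx _).1; apply: (IHz _).1.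
  by apply: (IHz _).2; apply: (IHx _).2.
Qed.

Lemma theta_pword v n m : theta (pword v) n = Some m <-> n = pval v m.
Proof.
have [L1 LM _ _] := theta_morph p; elim: v n m => [|a v IH] n m.
  by rewrite /pword big_nil L1 /=; split=> [[]|->].
rewrite /pword big_cons LM theta_gen pinj_mulE /=; split.
  by move=> [k /IH -> /R_funE ->].
by move=> ->; exists (p * m + a); [apply/IH|apply/R_funE].
Qed.

Lemma theta_normal u v n k :
  theta ((pword u)^-1 * pword v)%g n = Some k <->
  exists2 m, n = pval v m & k = pval u m.
Proof.
have [_ LM LV _] := theta_morph p; rewrite LM LV pinj_mulE.
split=> -[m].
  by move=> /theta_pword -> /pinj_inv_funE /theta_pword ->; exists m.
by move=> -> ->; exists m; [|apply/pinj_inv_funE]; apply/theta_pword.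
Qed.

Lemma pval_inj u v : 1 < p ->
  (forall m, exists m', pval u m = pval v m') ->
  (forall m, exists m', pval v m = pval u m') -> u = v.
Proof.
move=> p_gt1; have p_gt0 := ltnW p_gt1.
have modp m (a : 'I_p) : (p * m + a) %% p = a.
  by rewrite mulnC modnMDl modn_small.
have nil_rcons w a : ~ forall m, exists m', pval [::] m = pval (rcons w a) m'.
  move=> H; have [k /= k0] := H 0; have [l /= l1] := H 1.
  have := congr1 (modn^~ p) k0; have := congr1 (modn^~ p) l1.
  by rewrite /= !pval_rcons !modp mod0n modn_small // => <-.
elim/last_ind: u v => [|u a IH] v; case/lastP: v => [|v b] // H1 H2.
- by have := nil_rcons _ _ H1.
- by have := nil_rcons _ _ H2.
have ab : a = b.
  have [m E] := H1 0; have := congr1 (modn^~ p) E.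
  by rewrite /= !pval_rcons !modp => /val_inj.
have peel w w' : (forall m, exists m', pval (rcons w b) m = pval (rcons w' b) m')
    -> forall m, exists m', pval w m = pval w' m'.
  move=> H m; have [m'] := H m; rewrite !pval_rcons => /addIn /eqP.
  by rewrite eqn_pmul2l // => /eqP; exists m'.
by rewrite ab in H1 H2 *; rewrite (IH v) //; apply: peel.
Qed.

Lemma theta_injective : 1 < p -> injective (@theta p).
Proof.
move=> p_gt1; have [_ _ _ Le] := theta_morph p.
have nz u v : theta ((pword u)^-1 * pword v)%g <> epsg.
  move=> E; suff: theta ((pword u)^-1 * pword v)%g (pval v 0) = Some (pval u 0).
    by rewrite E.
  by apply/theta_normal; exists 0.
move=> x y.
case: (polycyclic_normal x) => [->|[u [v ->]]];
case: (polycyclic_normal y) => [->|[u' [v' ->]]] //; rewrite ?Le => E //.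
- by case: (nz u' v').
- by case: (nz _ _ E).
have sub w1 w2 w3 w4 : 
    theta ((pword w1)^-1 * pword w2)%g = theta ((pword w3)^-1 * pword w4)%g ->
    forall m, exists2 m', pval w2 m = pval w4 m' & pval w1 m = pval w3 m'.
  move=> F m; have: theta ((pword w1)^-1 * pword w2)%g (pval w2 m)
                  = Some (pval w1 m) by apply/theta_normal; exists m.
  by rewrite F => /theta_normal.
have H1 := sub _ _ _ _ E; have H2 := sub _ _ _ _ (esym E).
suff [-> ->] : u = u' /\ v = v' by [].
split; apply: pval_inj => // m.
- by have [m' ? ?] := H1 m; exists m'.
- by have [m' ? ?] := H2 m; exists m'.
- by have [m' ? ?] := H1 m; exists m'.
- by have [m' ? ?] := H2 m; exists m'.
Qed.

End Injectivity.
End Theta.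

Local Close Scope group_scope.
Local Open Scope ring_scope.
Local Open Scope classical_set_scope.

(* For a prime [p] and [n != 0], [logn p n] is the largest [k] such that [p ^ k]
   divides [n], see [pfactor_dvdn].                                          *)
Definition padic_norm (p n : nat) : rat := p%:R ^- logn p n.

Definition is_minimum (A : set rat) (x : rat) : Prop := (A `&` lbound A) x.

(* Main.v *)
Require Import Defs.
From mathcomp Require Import all_boot all_order all_algebra.
From mathcomp Require Import boolp classical_sets.

Import Order.TTheory GRing.Theory Num.Theory.

Local Open Scope ring_scope.
Local Open Scope classical_set_scope.

(** The generator 0 acts as division by [p], defined exactly on the multiples of [p]. Hence its
    [k]-th power is defined at [n] iff [p ^ k] divides [n] ([theta_gen0X]), and the ratio of its
    value to [n] is then [p ^- k]. This decreases in [k], so the minimum is reached at the largest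
    admissible exponent, [logn p n]. *)

Lemma theta_gen0X (p : nat) (a : 'I_p) (k n m : nat) : a = 0%N :> nat ->
  theta (pgen a ^+ k)%g n = Some m <-> n = (p ^ k * m)%N.
Proof.
move=> a0; have [L1 LM _ _] := theta_morph p.
elim: k n m => [|k IHk] n m.
  by rewrite expg0 L1 /= expn0 mul1n; split=> [[]|->].
(* The right factor acts first: [k] divisions send [n] to the intermediate value [p * m], and the
   new left factor divides once more. *)
rewrite expgS LM theta_gen pinj_mulE /= expnSr -mulnA; split.
  by move=> [y /IHk -> /R_funE ->]; rewrite a0 addn0.
by move=> ->; exists (p * m)%N; [apply/IHk | apply/R_funE; rewrite a0 addn0].
Qed.

Lemma natr_divMl (b m : nat) : m <> 0%N ->
  m%:R / (b * m)%:R = b%:R^-1 :> rat.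
Proof.
move=> /eqP m0; rewrite natrM invfM mulrCA divff ?mulr1 //.
by rewrite pnatr_eq0.
Qed.

Theorem corollary47 (p : nat) (p_prime : prime p) (n : nat) (n_neq0 : n <> 0%N) :
  is_minimum
    [set q : rat | exists k m : nat,
       theta (pgen (Ordinal (prime_gt0 p_prime)) ^+ k)%g n = Some m /\
       q = m%:R / n%:R]
    (padic_norm p n).
Proof.
have p_gt0 := prime_gt0 p_prime.
have quotE k m : n = (p ^ k * m)%N -> m%:R / n%:R = p%:R ^- k :> rat.
  move=> nE; rewrite nE natr_divMl ?natrX // => m0.
  by apply: n_neq0; rewrite nE m0 muln0.
split=> [|_ [k [m [/theta_gen0X nE ->]]]].
  have nE : n = (p ^ logn p n * (n %/ p ^ logn p n))%N.
    by rewrite mulnC divnK ?pfactor_dvdnn.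
  exists (logn p n), (n %/ p ^ logn p n)%N.
  by split; [apply/theta_gen0X | rewrite (quotE _ _ nE)].
(* [erefl] discharges the condition that the generator has value 0. *)
have {}nE := nE erefl.
have k_le : (k <= logn p n)%N.
  rewrite -pfactor_dvdn // ?nE ?dvdn_mulr // -nE.
  by rewrite lt0n; apply/eqP.
(* Inversion reverses the order on positive rationals, so it remains to compare the powers of [p]
   through [k_le]. *)
rewrite (quotE _ _ nE) /padic_norm lef_pV2 ?posrE ?exprn_gt0 ?ltr0n //.
by rewrite ler_weXn2l // ler1n.
Qed.
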